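(* Let $(Z,\mathcal{M})$ be a complete and ptolemaic Möbius space. Then there exists an asymptotically $\mathrm{PT}_{-1}$ metric space $X$ such that $\partial_\infty X$ with its canonical Möbius structure is Möbius equivalent to $(Z,\mathcal{M})$, i.e. there is a bijection $\partial_\infty X\to Z$ which is a Möbius map with respect to the canonical Möbius structure on $\partial_\infty X$ and $\mathcal{M}$.
   Context: **Asymptotically $\mathrm{PT}_{-1}$.** A metric space $(X,d)$ is asymptotically $\mathrm{PT}_{-1}$ if there exists $\delta>0$ such that for all $x_1,x_2,x_3,x_4\in X$, with $\rho_{i,j}=d(x_i,x_j)$ and $\rho=\max_{i,j}\rho_{i,j}$, $$e^{\frac12(\rho_{1,3}+\rho_{2,4})}\le e^{\frac12(\rho_{1,2}+\rho_{3,4})}+e^{\frac12(\rho_{1,4}+\rho_{2,3})}+\delta e^{\frac12\rho}.$$ **Boundary at infinity.** The Gromov product is $(x|y)_o=\frac12(d(o,x)+d(o,y)-d(x,y))$. A sequence $(x_i)$ in $X$ converges at infinity if $\lim_{i,j\to\infty}(x_i|x_j)_o=\infty$ for some (hence every) $o\in X$. Two such sequences are equivalent if $\lim_i(x_i|y_i)_o=\infty$. $\partial_\infty X$ is the set of equivalence classes. For $\zeta,\xi\in\partial_\infty X$, $(\zeta|\xi)_o=\inf\liminf_{i\to\infty}(x_i|y_i)_o$, infimum over all $(x_i)\in\zeta$, $(y_i)\in\xi$. If $X$ is asymptotically $\mathrm{PT}_{-1}$, then $X$ is Gromov hyperbolic, for each $o\in X$ the function $\rho_o(\zeta,\xi)=e^{-(\zeta|\xi)_o}$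 (with $e^{-\infty}=0$) is a metric on $\partial_\infty X$, and these metrics for different $o$ are Möbius equivalent; the canonical Möbius structure of $\partial_\infty X$ is the Möbius equivalence class of $\rho_o$. **Möbius structures.** Let $Z$ be a set with at least two points. An extended metric on $Z$ is a map $d:Z\times Z\to[0,\infty]$ for which there is a set $\Omega(d)\subset Z$ of cardinality $0$ or $1$ such that $d$ restricted to $Z\setminus\Omega(d)$ is a (finite) metric, $d(z,\omega)=\infty$ for $z\in Z\setminus\Omega(d)$, $\omega\in\Omega(d)$, and $d(\omega,\omega)=0$. If $\Omega(d)=\{\omega\}$, $\omega$ is called the point at infinity; write $Z_\omega=Z\setminus\{\omega\}$ (and $Z_\omega=Z$ if $\Omega(d)=\emptyset$). $(Z,d)$ is complete if every Cauchy sequence in $Z_\omega$ converges and, in case $Z_\omega$ is unbounded, the point at infinity exists. A quadruple in $Z^4$ is admissible if no entry occurs three or four times. The cross ratio triple of an admissible quadruple is $$\mathrm{crt}(x,y,z,w)=(d(x,y)d(z,w):d(x,z)d(y,w):d(x,w)d(y,z))\in\mathbb{R}P^2,$$ with infinite distances cancelled: if $w$ is the point at infinity and the other entries are not, it is $(d(x,y):d(x,z):d(y,z))$; if $z=w$ is the point at infinity it is $(0:1:1)$; analogously for other positions. A map between extended metric spaces is Möbius if it is injective and preserves $\mathrm{crt}$ of all admissible quadruples. Two extended metrics on $Z$ are Möbius equivalent if the identity map between them is Möbius. A Möbius structure $\mathcal{M}$ on $Z$ is a Möbius equivalence class of extended metrics, and $(Z,\mathcal{M})$ is then a Möbius space;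 a map between Möbius spaces is Möbius if it is so for some (equivalently any) choice of metrics in the two structures. $\mathcal{M}$ is complete if some (equivalently every) metric in it is complete, and ptolemaic if for some (equivalently every) metric in it the entries $a,b,c$ of $\mathrm{crt}=(a:b:c)$ (taken nonnegative) satisfy the triangle inequalities for all admissible quadruples. *)

(* Defs.v *)
From mathcomp Require Import all_boot all_order all_algebra.
From mathcomp Require Import all_classical all_reals all_analysis.

Set Implicit Arguments.
Unset Strict Implicit.
Unset Printing Implicit Defensive.

Import Order.TTheory GRing.Theory Num.Theory.
Import numFieldNormedType.Exports.

Local Open Scope classical_set_scope.
Local Open Scope ring_scope.

Section extended_metrics.
Variables (R : realType) (Z : Type).
Implicit Types (d : Z -> Z -> \bar R) (Om : set Z).

(* [Om] is the set of points at infinity of [d].  It is determined by [d]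
   unless Z = {a, b} and d a b = +oo, in which case both {a} and {b} qualify. *)
Definition ext_metric_at Om d : Prop :=
  (forall w w', Om w -> Om w' -> w = w') /\
  [/\ forall x y, ~ Om x -> ~ Om y ->
        [/\ d x y \is a fin_num, (0 <= d x y)%E, d x y = 0%E <-> x = y
          & d x y = d y x],
      forall x y z, ~ Om x -> ~ Om y -> ~ Om z ->
        (d x z <= d x y + d y z)%E,
      forall z w, ~ Om z -> Om w -> d z w = +oo%E /\ d w z = +oo%E
    & forall w, Om w -> d w w = 0%E].

Definition ext_metric d : Prop := exists Om, ext_metric_at Om d.

Definition ext_complete d : Prop :=
  exists Om, [/\ ext_metric_at Om d,
    forall u : nat -> Z, (forall n, ~ Om (u n)) ->
      (forall e : R, 0 < e ->
         \forall p \near (\oo, \oo), (d (u p.1) (u p.2) < e%:E)%E) ->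
      exists2 l, ~ Om l & d (u n) l @[n --> \oo] --> 0%E
  & ~ (exists r : R, forall x y, ~ Om x -> ~ Om y -> (d x y <= r%:E)%E) ->
      Om !=set0].

Definition admissible (x y z w : Z) : Prop :=
  [/\ ~ (x = y /\ y = z), ~ (x = y /\ y = w),
      ~ (x = z /\ z = w) & ~ (y = z /\ z = w)].

(* Cancelling the infinite distances amounts to replacing them by 1: if
   exactly one entry of an admissible quadruple is the point at infinity, each
   product in [crt] has exactly one infinite factor; if two entries are, one
   product is d(w,w) d(x,y) = 0 and both factors of the other two products are
   infinite, which gives (0 : 1 : 1) up to the position of 0. *)
Definition cancel_infty (a : \bar R) : R := if a is r%:E then r else 1.

(* Homogeneous coordinates, with nonnegative entries, of the cross ratio
   triple; the point of RP^2 is their class under [proj_eq]. *)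
Definition crt d (x y z w : Z) : R * R * R :=
  let D a b := cancel_infty (d a b) in
  (D x y * D z w, D x z * D y w, D x w * D y z).

Definition ptolemaic d : Prop :=
  forall x y z w, admissible x y z w ->
    let: (a, b, c) := crt d x y z w in
    [/\ a <= b + c, b <= a + c & c <= a + b].

End extended_metrics.

Definition proj_eq (R : realType) (p q : R * R * R) : Prop :=
  exists2 k : R, k != 0 &
    [/\ p.1.1 = k * q.1.1, p.1.2 = k * q.1.2 & p.2 = k * q.2].

Definition mobius_map (R : realType) (Z Z' : Type)
    (d : Z -> Z -> \bar R) (d' : Z' -> Z' -> \bar R) (f : Z -> Z') : Prop :=
  injective f /\
  forall x y z w, admissible x y z w ->
    proj_eq (crt d' (f x) (f y) (f z) (f w)) (crt d x y z w).

Section mobius_structures.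
Variables (R : realType) (Z : Type).
Implicit Types (d : Z -> Z -> \bar R) (M : set (Z -> Z -> \bar R)).

Definition mobius_equiv d d' : Prop :=
  [/\ ext_metric d, ext_metric d' & mobius_map d d' id].

Definition mobius_class d : set (Z -> Z -> \bar R) :=
  [set d' | mobius_equiv d d'].

Definition mobius_structure M : Prop :=
  exists2 d, ext_metric d & M = mobius_class d.

Definition complete_structure M : Prop := exists2 d, M d & ext_complete d.

Definition ptolemaic_structure M : Prop := exists2 d, M d & ptolemaic d.

End mobius_structures.

Definition mobius_space_map (R : realType) (Z Z' : Type)
    (M : set (Z -> Z -> \bar R)) (M' : set (Z' -> Z' -> \bar R))
    (f : Z -> Z') : Prop :=
  exists d d', [/\ M d, M' d' & mobius_map d d' f].

Section metric_spaces.
Variables (R : realType) (X : metricType R).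
Implicit Types (o x y : X) (u v : nat -> X).

Definition asymptotically_PT : Prop :=
  exists2 delta : R, 0 < delta & forall x1 x2 x3 x4 : X,
    let rho := Num.max (mdist x1 x2) (Num.max (mdist x1 x3)
      (Num.max (mdist x1 x4) (Num.max (mdist x2 x3)
      (Num.max (mdist x2 x4) (mdist x3 x4))))) in
    expR (2^-1 * (mdist x1 x3 + mdist x2 x4)) <=
      expR (2^-1 * (mdist x1 x2 + mdist x3 x4)) +
      expR (2^-1 * (mdist x1 x4 + mdist x2 x3)) +
      delta * expR (2^-1 * rho).

Definition gromov_prod o x y : R :=
  2^-1 * (mdist o x + mdist o y - mdist x y).

Definition converges_at_infty u : Prop :=
  exists o, gromov_prod o (u p.1) (u p.2) @[p --> (\oo, \oo)] --> +oo.

Definition equiv_at_infty u v : Prop :=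
  exists o, gromov_prod o (u i) (v i) @[i --> \oo] --> +oo.

Definition boundary : set (set (nat -> X)) :=
  [set C | exists2 u, converges_at_infty u &
     C = [set v | converges_at_infty v /\ equiv_at_infty u v]].

(* [val] strips the proof that an element of the type [boundary] is an
   equivalence class. *)
Definition boundary_prod o (zeta xi : boundary) : \bar R :=
  ereal_inf [set l | exists u v, [/\ val zeta u, val xi v &
    l = limn_einf (fun i => (gromov_prod o (u i) (v i))%:E)]].

Definition boundary_dist o (zeta xi : boundary) : \bar R :=
  expeR (- boundary_prod o zeta xi)%E.

(* When X is asymptotically PT_{-1}, this does not depend on [o]. *)
Definition canonical_structure o : set (boundary -> boundary -> \bar R) :=
  mobius_class (boundary_dist o).

End metric_spaces.

Arguments asymptotically_PT {R} X.
Arguments boundary {R} X.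

(* Main.v *)
Require Import Defs.
From mathcomp Require Import all_boot all_order all_algebra.
From mathcomp Require Import all_classical all_reals all_analysis.
From mathcomp Require Import ring lra.
From HB Require Import structures.

(** The space [X] is a hyperbolic cone over [Z] with one point removed.

    Let [d] be a complete metric of the structure; it is ptolemaic because
    this only depends on the cross ratios.  Replacing the infinite distances
    by 1 turns [d] into a finite, symmetric, nonnegative kernel [K] on [Z] that
    vanishes exactly on the diagonal and satisfies the Ptolemy inequality for
    all quadruples; the cross ratio triples of [d] are those of [K], and they
    do not change under [K x y -> g x * g y * K x y] with [g > 0].  Let [w] be
    the point at infinity of [d] if there is one and any point of [Z]
    otherwise.  After the rescaling with [g x = 1 / K x w] for [x <> w] (an
    inversion at [w]) the Ptolemy inequality with fourth point [w] is the
    triangle inequality on [Z] minus [w], and this metric is complete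
    ([kernel_inversion_complete]; when [d] has no point at infinity it is
    bounded, and then the inversion preserves completeness).

    The cone consists of the pairs [(x, h)] with [x <> w] and [h > 0].  With
    [csep (x, h) (y, k) = K x y + max h k] its distance is
    [2 ln (csep p q) - ln h - ln k].  The Ptolemy inequality for [K] gives
    [csep p1 p3 * csep p2 p4 <= csep p1 p2 * csep p3 p4 +
     csep p1 p4 * csep p2 p3] up to an error that the exponential of half the
    largest distance controls with [delta = 1] ([csep_PT], [cone_PT]).

    The point of this distance is the identity [expR_gromov],
    [exp (- (p|q)_o) = csep p q * h_o / (csep o p * csep o q)].
    If [p] and [q] tend to boundary points [z] and [z'], the right-hand side
    converges to [bdist o z z'], which is [K z z'] rescaled as above
    ([cvg_gromov]); here tending to [x <> w] means tending to [(x, 0)], and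
    tending to [w] means leaving every bounded set.  Sequences that converge
    at infinity are exactly those that tend to some point
    ([converges_tends], where completeness enters), and two of them are
    equivalent exactly when they tend to the same point.  So the boundary is
    identified with [Z] and its metric with [bdist o]
    ([boundary_coordinate]), which has the cross ratios of [K].  The triangle
    inequality for [bdist o] is again a combination of Ptolemy inequalities. *)

Set Implicit Arguments.
Unset Strict Implicit.
Unset Printing Implicit Defensive.

Import Order.TTheory GRing.Theory Num.Theory.
Import numFieldNormedType.Exports.

(** * Ptolemaic kernels *)

(** A metric with the triangle inequality replaced by the Ptolemy inequality.
    This class of functions is stable under [K x y -> g x * g y * K x y] with
    [g > 0], and it contains every ptolemaic extended metric whose infinite
    values are replaced by 1. *)
Record ptolemaic_kernel (R : realType) (Z : Type) (K : Z -> Z -> R) : Prop := {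
  ker_ge0 : forall x y, (0 <= K x y)%R;
  ker_eq0 : forall x y, K x y = 0%R <-> x = y;
  ker_sym : forall x y, K x y = K y x;
  ker_ptolemy : forall x y z w,
    (K x z * K y w <= K x y * K z w + K x w * K y z)%R }.

(** Kernels normalised so that the finite number 1 stands for the infinite
    distances to the point [w]. *)
Record kernel_at_infty (R : realType) (Z : Type) (K : Z -> Z -> R) (w : Z) :
    Prop := {
  infty_kernel :> ptolemaic_kernel K;
  ker_infty : forall x, x <> w -> K x w = 1%R }.

(** * The hyperbolic cone *)

Section cone.
Local Open Scope classical_set_scope.
Local Open Scope ring_scope.
Variables (R : realType) (Z : Type) (K : Z -> Z -> R) (w : Z).

Lemma ker_xx (H : ptolemaic_kernel K) x : K x x = 0.
Proof. exact/(ker_eq0 H). Qed.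

Lemma ker_gt0 (H : ptolemaic_kernel K) x y : x <> y -> 0 < K x y.
Proof.
move=> xy; rewrite lt_neqAle (ker_ge0 H) andbT eq_sym.
by apply/eqP => /(ker_eq0 H).
Qed.

(** The Ptolemy inequality for the quadruple [x, y, z, w]. *)
Lemma ker_triangle (H : kernel_at_infty K w) y x z :
  x <> w -> y <> w -> z <> w -> K x z <= K x y + K y z.
Proof.
move=> xw yw zw; have := ker_ptolemy H x y z w.
by rewrite !(ker_infty H)// !mulr1 mul1r.
Qed.

(** The hyperbolic cone over [Z] minus [w].  The proof [H] is an argument of the
    type because the metric structure below depends on it. *)
Definition cone (H : kernel_at_infty K w) : Type :=
  ({z : Z | z <> w} * {posnum R})%type.

Variable H : kernel_at_infty K w.
Implicit Types p q r o : cone H.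

HB.instance Definition _ := gen_eqMixin (cone H).
HB.instance Definition _ := gen_choiceMixin (cone H).

Definition base p : Z := sval p.1.
Definition height p : R := p.2%:num.
(** The scale at which [p] and [q] separate: the exponential of half their
    distance, multiplied by the square roots of their heights. *)
Definition csep p q : R := K (base p) (base q) + Num.max (height p) (height q).

Lemma base_neq p : base p <> w. Proof. exact: (svalP p.1). Qed.

Lemma height_gt0 p : 0 < height p. Proof. by rewrite /height. Qed.

Lemma cone_eq p q : base p = base q -> height p = height q -> p = q.
Proof.
move: p q => [[x xw] h] [[y yw] k]; rewrite /base /height /= => xy /val_inj ->.
by move: xy xw yw => -> xw yw; congr ((exist _ _ _), _); exact: Prop_irrelevance.
Qed.

Lemma csep_ge p q : [/\ K (base p) (base q) <= csep p q,
  height p <= csep p q & height q <= csep p q].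
Proof.
have K0 := ker_ge0 H (base p) (base q).
have hp := height_gt0 p.
have [M1 M2] : height p <= Num.max (height p) (height q) /\
    height q <= Num.max (height p) (height q) by rewrite !le_max !lexx orbT.
by rewrite /csep; split; lra.
Qed.

Lemma csep_gt0 p q : 0 < csep p q.
Proof. by have [_ + _] := csep_ge p q; apply: lt_le_trans; exact: height_gt0. Qed.

Lemma csepC p q : csep p q = csep q p.
Proof. by rewrite /csep (ker_sym H) maxC. Qed.

(** The triangle inequality for [cone_dist], in multiplicative form. *)
Lemma csep_triangle q p r :
  csep p r * height q <= csep p q * csep q r.
Proof.
have T := ker_triangle H (y := base q) (@base_neq p) (@base_neq q) (@base_neq r).
have [hp hq hr] := And3 (height_gt0 p) (height_gt0 q) (height_gt0 r).
have [a0 b0] := (ker_ge0 H (base p) (base q), ker_ge0 H (base q) (base r)).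
move: T a0 b0 hp hq hr; rewrite /csep.
move: (K (base p) (base r)) (K (base p) (base q)) (K (base q) (base r)).
move: (height p) (height q) (height r) => h k l c a b.
move=> T a0 b0 h0 k0 l0.
have [M1 M2] : h <= Num.max h k /\ k <= Num.max h k by rewrite !le_max !lexx orbT.
have [N1 N2] : k <= Num.max k l /\ l <= Num.max k l by rewrite !le_max !lexx orbT.
have Q : Num.max h l <= h \/ Num.max h l <= l.
  by case: (leP h l) => _; [right|left].
move: (Num.max h k) (Num.max k l) (Num.max h l) M1 M2 N1 N2 Q => m n s M1 M2 N1 N2 Q.
suff : s * k <= m * n by nra.
by case: Q => Q; nra.
Qed.

Definition cone_dist p q : R :=
  2 * ln (csep p q) - ln (height p) - ln (height q).

Lemma cone_distxx p : cone_dist p p = 0.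
Proof. by rewrite /cone_dist /csep maxxx (ker_xx H) add0r; ring. Qed.

Lemma cone_dist_sym p q : cone_dist p q = cone_dist q p.
Proof. by rewrite /cone_dist csepC; ring. Qed.

Lemma cone_dist_positivity p q : cone_dist p q = 0 -> p = q.
Proof.
move=> pq; have {pq} : ln (csep p q * csep p q) = ln (height p * height q).
  rewrite !lnM ?posrE ?csep_gt0 ?height_gt0//.
  by move: pq; rewrite /cone_dist => pq; lra.
have [hp hq] := (height_gt0 p, height_gt0 q).
have K0 := ker_ge0 H (base p) (base q).
move/ln_inj; rewrite !posrE !mulr_gt0 ?csep_gt0// => /(_ isT isT).
rewrite /csep => E.
have [K1 hh] : K (base p) (base q) = 0 /\ height p = height q.
  move: E hp hq K0.
  move: (K _ _) (height p) (height q) => a h k.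
  by case: (leP h k) => hk E h0 k0 a0; split; nra.
by apply: cone_eq => //; exact/(ker_eq0 H).
Qed.

Lemma cone_dist_triangle q p r : cone_dist p r <= cone_dist p q + cone_dist q r.
Proof.
have := csep_triangle q p r.
rewrite -ler_ln ?posrE ?mulr_gt0 ?csep_gt0 ?height_gt0//.
rewrite !lnM ?posrE ?csep_gt0 ?height_gt0// /cone_dist; lra.
Qed.

HB.instance Definition _ := @isMetric.Build R (cone H) cone_dist
  cone_distxx cone_dist_positivity cone_dist_sym cone_dist_triangle.

(** The last two factors are the square roots of the heights. *)
Lemma expR_half_dist p q : expR (2^-1 * mdist p q) =
  csep p q / (expR (2^-1 * ln (height p)) * expR (2^-1 * ln (height q))).
Proof.
rewrite -expRD -expRN -[X in X * expR _](@lnK R) ?posrE ?csep_gt0// -expRD.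
by congr expR; rewrite /mdist/= /cone_dist; field.
Qed.

(** In the Gromov product the heights of [p] and [q] cancel. *)
Lemma expR_gromov o p q : expR (- gromov_prod o p q) =
  csep p q * height o / (csep o p * csep o q).
Proof.
have cg := csep_gt0; have hg := height_gt0.
rewrite -[RHS]lnK ?posrE ?divr_gt0 ?mulr_gt0//; congr expR.
rewrite ln_div ?posrE ?mulr_gt0// !lnM ?posrE//.
by rewrite /gromov_prod /mdist/= /cone_dist; field.
Qed.

(** The mixed terms of the left-hand side are estimated by [a13 * h2 <= (a14 + a34) * h2] and
    [a24 * h1 <= (a23 + a34) * h1].  All of this occurs in the first two
    products on the right, except that [a34 * (h1 + h2)] occurs only as
    [a34 * max h1 h2]; the excess [a34 * min h1 h2] is at most
    [a34 * sqrt (h1 * h2)]. *)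
Lemma csep_PT p1 p2 p3 p4 (s1 s2 : R) : 0 < s1 -> 0 < s2 ->
  s1 * s1 = height p1 -> s2 * s2 = height p2 ->
  height p3 <= height p1 -> height p4 <= height p2 ->
  csep p1 p3 * csep p2 p4 <= csep p1 p2 * csep p3 p4 +
    csep p1 p4 * csep p2 p3 + csep p3 p4 * (s1 * s2).
Proof.
move=> s10 s20 E1 E2 h31 h42; rewrite /csep (max_l h31) (max_l h42).
have b1 := @base_neq p1. have b2 := @base_neq p2.
have b3 := @base_neq p3. have b4 := @base_neq p4.
have P := ker_ptolemy H (base p1) (base p2) (base p3) (base p4).
have T1 := ker_triangle H b1 b4 b3; rewrite (ker_sym H (base p4)) in T1.
have T2 := ker_triangle H b2 b3 b4.
have := (ker_ge0 H (base p1) (base p2)).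
have := (ker_ge0 H (base p3) (base p4)).
have := (ker_ge0 H (base p1) (base p4)).
have := (ker_ge0 H (base p2) (base p3)).
have := height_gt0 p1. have := height_gt0 p2.
have := height_gt0 p3. have := height_gt0 p4.
move: P T1 T2 h31 h42 E1 E2.
move: (K (base p1) (base p3)) (K (base p2) (base p4)) (K (base p1) (base p2))
  (K (base p3) (base p4)) (K (base p1) (base p4)) (K (base p2) (base p3)).
move=> a13 a24 a12 a34 a14 a23.
move: (height p1) (height p2) (height p3) (height p4) => h1 h2 h3 h4.
move=> P T1 T2 h31 h42 E1 E2 h40 h30 h20 h10 a230 a140 a340 a120.
have M14 : h1 <= Num.max h1 h4 by rewrite le_max lexx.
have M23 : h2 <= Num.max h2 h3 by rewrite le_max lexx.
have M34 : 0 < Num.max h3 h4 by rewrite lt_max h30.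
have M12 : h1 + h2 <= Num.max h1 h2 + s1 * s2.
  by rewrite -E1 -E2; case: (leP (s1 * s1) (s2 * s2)) => ss; nra.
have M0 : 0 <= Num.max h1 h2 by rewrite le_max ltW.
move: (Num.max h1 h2) (Num.max h1 h4) (Num.max h2 h3) (Num.max h3 h4)
  M12 M14 M23 M34 M0 => m12 m14 m23 m34 M12 M14 M23 M34 M0.
have Q1 : a13 * h2 <= (a14 + a34) * h2 by apply: ler_wpM2r => //; exact: ltW.
have Q2 : a24 * h1 <= (a23 + a34) * h1 by apply: ler_wpM2r => //; exact: ltW.
have Q3 : h1 * h2 <= m14 * m23 by apply: ler_pM => //; exact: ltW.
have Q4 : a34 * (h1 + h2) <= a34 * (m12 + s1 * s2) by rewrite ler_wpM2l.
have Q5 : a14 * h2 <= a14 * m23 by rewrite ler_wpM2l.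
have Q6 : a23 * h1 <= a23 * m14 by rewrite ler_wpM2l.
have Q7 : 0 <= a12 * m34 by apply: mulr_ge0 => //; exact: ltW.
have Q8 : 0 <= m12 * m34 by apply: mulr_ge0 => //; exact: ltW.
have Q9 : 0 < m34 * (s1 * s2) by rewrite !mulr_gt0.
lra.
Qed.

Lemma cone_PT : asymptotically_PT (cone H).
Proof.
exists 1 => [//|p1 p2 p3 p4]; set rho := Num.max _ _; cbv zeta.
pose s p : R := expR (2^-1 * ln (height p)).
have s0 p : 0 < s p by exact: expR_gt0.
have ss p : s p * s p = height p.
  rewrite /s -expRD (_ : _ + _ = ln (height p)); last by field.
  by rewrite lnK// posrE height_gt0.
have E p q : expR (2^-1 * mdist p q) = csep p q / (s p * s q).
  exact: expR_half_dist.
have cE p q : mdist p q <= rho -> csep p q <= s p * s q * expR (2^-1 * rho).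
  move=> pq; rewrite mulrC -ler_pdivrMr ?mulr_gt0// -E ler_expR.
  by rewrite ler_pM2l.
have [c12 c14 c23 c34] : [/\ csep p1 p2 <= s p1 * s p2 * expR (2^-1 * rho),
    csep p1 p4 <= s p1 * s p4 * expR (2^-1 * rho),
    csep p2 p3 <= s p2 * s p3 * expR (2^-1 * rho) &
    csep p3 p4 <= s p3 * s p4 * expR (2^-1 * rho)].
  by split; apply: cE; rewrite /rho !le_max !lexx ?orbT.
have EE p q p' q' : expR (2^-1 * (mdist p q + mdist p' q')) =
    csep p q / (s p * s q) * (csep p' q' / (s p' * s q')).
  by rewrite mulrDr expRD !E.
rewrite !EE mul1r.
set e := expR _ in c12 c14 c23 c34 *.
have S0 : 0 < s p1 * s p2 * s p3 * s p4 by rewrite !mulr_gt0.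
rewrite -(ler_pM2r S0).
have sn p : s p != 0 by rewrite gt_eqF.
rewrite [leLHS](_ : _ = csep p1 p3 * csep p2 p4); last by field; rewrite ?sn.
rewrite [leRHS](_ : _ = csep p1 p2 * csep p3 p4 + csep p1 p4 * csep p2 p3 +
   s p1 * s p2 * s p3 * s p4 * e); last by field; rewrite ?sn.
have X q1 q2 q3 q4 : height q3 <= height q1 -> height q4 <= height q2 ->
    csep q3 q4 <= s q3 * s q4 * e ->
    csep q1 q3 * csep q2 q4 <= csep q1 q2 * csep q3 q4 +
      csep q1 q4 * csep q2 q3 + s q1 * s q2 * s q3 * s q4 * e.
  move=> h31 h42 c; apply: (le_trans (csep_PT (s0 q1) (s0 q2) (ss _) (ss _) h31 h42)).
  rewrite lerD2l.
  rewrite (_ : s q1 * _ * _ * _ * _ = s q3 * s q4 * e * (s q1 * s q2)); last by ring.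
  by rewrite ler_wpM2r// mulr_ge0 ?ltW.
(* The inequality is invariant under exchanging the first and third points
   and under exchanging the second and fourth, so [csep_PT] covers every order
   of the heights. *)
have [h31|/ltW h13] := leP (height p3) (height p1);
  have [h42|/ltW h24] := leP (height p4) (height p2).
- exact: X.
- have := X p1 p4 p3 p2 h31 h24; rewrite !(csepC p3 p2) !(csepC p4 p2) !(csepC p4 p3).
  by rewrite [s p3 * s p2]mulrC => /(_ c23); lra.
- have := X p3 p2 p1 p4 h13 h42; rewrite !(csepC p3 p2) !(csepC p3 p1) !(csepC p2 p1).
  by move=> /(_ c14); lra.
- have := X p3 p4 p1 p2 h13 h24; rewrite !(csepC p3 p1) !(csepC p4 p1).
  rewrite !(csepC p4 p2) !(csepC p3 p2).
  by move=> /(_ c12); lra.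
Qed.

End cone.

(** * Limits in the cone *)

Section limits.
Local Open Scope classical_set_scope.
Local Open Scope ring_scope.
Variables (R : realType) (Z : Type) (K : Z -> Z -> R) (w : Z).
Variable H : kernel_at_infty K w.
Implicit Types p q r o : cone H.

Lemma csep_triangle_add q p r : csep p r <= csep p q + csep q r.
Proof.
have T := ker_triangle H (@base_neq _ _ _ _ _ p) (@base_neq _ _ _ _ _ q)
  (@base_neq _ _ _ _ _ r).
have hq := height_gt0 q; rewrite /csep.
have [M1 M2] : height p <= Num.max (height p) (height q) /\
    height q <= Num.max (height p) (height q) by rewrite !le_max !lexx orbT.
have [N1 N2] : height q <= Num.max (height q) (height r) /\
    height r <= Num.max (height q) (height r) by rewrite !le_max !lexx orbT.
by case: (leP (height p) (height r)) => _; lra.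
Qed.

Lemma ker_dist x y z : x <> w -> y <> w -> z <> w -> `|K x z - K y z| <= K x y.
Proof.
move=> xw yw zw; have T1 := ker_triangle H xw yw zw.
have T2 := ker_triangle H yw xw zw; rewrite (ker_sym H y x) in T2.
by rewrite ler_norml; apply/andP; split; lra.
Qed.

(** Convergence to the boundary point [z]: to height 0 above [z] if [z] is not
    [w], and out of every bounded set if [z = w]. *)
Definition tends (T : Type) (F : set_system T) (u : T -> cone H) (z : Z) : Prop :=
  (z <> w -> K (base (u t)) z + height (u t) @[t --> F] --> (0 : R)) /\
  (z = w -> exists o, csep o (u t) @[t --> F] --> +oo).

(** The limit of [csep o p] as [p] tends to [z <> w], and 1 for [z = w].  Written
    with two values of the kernel it is accessible to the Ptolemy
    inequality. *)
Definition vis o (z : Z) : R := K z (base o) + height o * K z w.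

(** The metric induced on the boundary, which is identified with [Z]; it is
    [K] rescaled by a positive function. *)
Definition bdist o (z z' : Z) : R := K z z' * height o / (vis o z * vis o z').

Lemma vis_gt0 o z : 0 < vis o z.
Proof.
have hg := height_gt0 o; rewrite /vis.
have [->|zw] := pselect (z = w).
  rewrite (ker_xx H) mulr0 addr0; apply: (ker_gt0 H).
  by move=> /esym; exact: base_neq.
by rewrite ltr_wpDl ?(ker_ge0 H)// mulr_gt0// (ker_gt0 H).
Qed.

Lemma bdist_ge0 o z z' : 0 <= bdist o z z'.
Proof.
by rewrite divr_ge0 ?mulr_ge0 ?(ker_ge0 H) ?(ltW (vis_gt0 _ _))// ltW// height_gt0.
Qed.

Lemma bdist_eq0 o z z' : bdist o z z' = 0 <-> z = z'.
Proof.
split=> [/eqP|->]; last by rewrite /bdist (ker_xx H) !mul0r.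
rewrite mulf_eq0 mulf_eq0 invr_eq0 mulf_eq0 !(gt_eqF (vis_gt0 _ _)).
by rewrite (gt_eqF (height_gt0 _)) !orbF => /eqP /(ker_eq0 H).
Qed.

Lemma bdist_sym o z z' : bdist o z z' = bdist o z' z.
Proof. by rewrite /bdist (ker_sym H) (mulrC (vis o z)). Qed.

(** Multiplied by the three factors [vis], this is the sum of the Ptolemy
    inequality with fourth point [base o] and of [height o] times the one with
    fourth point [w]. *)
Lemma bdist_triangle o y x z : bdist o x z <= bdist o x y + bdist o y z.
Proof.
have P1 := ker_ptolemy H x y z (base o).
have P2 := ker_ptolemy H x y z w.
have [vx vy vz] := And3 (vis_gt0 o x) (vis_gt0 o y) (vis_gt0 o z).
have ho := height_gt0 o.
have key : K x z * vis o y <= K x y * vis o z + K y z * vis o x.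
  rewrite /vis; have := ler_wpM2l (ltW ho) P2; lra.
rewrite -subr_ge0 [leRHS](_ : _ = height o * (K x y * vis o z + K y z * vis o x
   - K x z * vis o y) / (vis o x * vis o y * vis o z)).
  apply: divr_ge0; last by rewrite ltW// !mulr_gt0.
  by apply: mulr_ge0; [exact: ltW | rewrite subr_ge0].
by rewrite /bdist; field; rewrite !gt_eqF.
Qed.

Lemma gromov_sym o p q : gromov_prod o p q = gromov_prod o q p.
Proof. by rewrite /gromov_prod (metric_sym p q) (addrC (mdist o p)). Qed.

Section filter.
Variables (T : Type) (F : set_system T).
Context {FF : Filter F}.
Implicit Types u v : T -> cone H.

(** The base point in the definition of [tends] at [w] is immaterial. *)
Lemma far_basepoint o' o u :
  csep o (u t) @[t --> F] --> +oo -> csep o' (u t) @[t --> F] --> +oo.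
Proof.
move=> /cvgryPge A; apply/cvgryPge => M.
have [c0 h0] := (csep_gt0 o o', height_gt0 o').
apply: filterS (A (M * csep o o' / height o')) => t.
rewrite ler_pdivrMr// => B.
by rewrite -(ler_pM2r c0) (le_trans B)// [leRHS]mulrC csep_triangle.
Qed.

Lemma cvg_of_dist (f g : T -> R) (l : R) :
  (forall t, `|f t - l| <= g t) -> g @ F --> (0 : R) -> f @ F --> l.
Proof.
move=> fg g0.
apply: (@squeeze_cvgr _ _ _ _ (fun t => l - g t) (fun t => l + g t)).
- apply: nearW => t; move: (fg t); rewrite ler_norml => /andP[? ?].
  by apply/andP; split; lra.
- by rewrite -[X in _ --> X]subr0; apply: cvgB => //; exact: cvg_cst.
- by rewrite -[X in _ --> X]addr0; apply: cvgD => //; exact: cvg_cst.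
Qed.

Lemma cvg_csep_base o u z : z <> w -> tends F u z ->
  csep o (u t) @[t --> F] --> vis o z.
Proof.
move=> zw uz; have uz' := uz.1 zw; apply: (cvg_of_dist _ uz') => t.
have := ker_dist zw (@base_neq _ _ _ _ _ (u t)) (@base_neq _ _ _ _ _ o).
rewrite /csep /vis (ker_infty H zw) mulr1 (ker_sym H (base o)) (ker_sym H z (base (u t))).
have := height_gt0 o; have := height_gt0 (u t).
rewrite !ler_norml => h0 h1 /andP[? ?].
by case: (leP (height o) (height (u t))) => ?; apply/andP; split; lra.
Qed.

Lemma cvg_csep_inv o u z : tends F u z ->
  height o / csep o (u t) @[t --> F] --> height o * K z w / vis o z.
Proof.
move=> uz; rewrite -mulrA; apply: cvgMl_tmp.
have [zw|zw] := pselect (z = w); last first.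
  rewrite (ker_infty H zw) mul1r; apply: cvgV; first by rewrite gt_eqF ?vis_gt0.
  exact: cvg_csep_base.
rewrite zw (ker_xx H) mul0r; apply/gtr0_cvgV0.
  by apply: nearW => t; exact: csep_gt0.
by have [b uo] := uz.2 zw; exact: far_basepoint uo.
Qed.

(** As [csep (u t) (v t)] and [csep o (u t)] differ by at most
    [csep o (v t)], the exponential of the Gromov product differs from
    [height o / csep o (v t)] by at most [height o / csep o (u t)], which tends
    to 0.  The limit point [z'] may be [w] as well. *)
Lemma cvg_gromov_infty o u v z' : tends F u w -> tends F v z' ->
  expR (- gromov_prod o (u t) (v t)) @[t --> F] --> bdist o w z'.
Proof.
move=> uw vz; rewrite (_ : bdist o w z' = height o * K z' w / vis o z'); last first.
  rewrite /bdist (_ : vis o w = 1) ?mul1r 1?(ker_sym H) 1?(mulrC (K _ _))//.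
  rewrite /vis (ker_xx H) mulr0 addr0 (ker_sym H) (ker_infty H)//.
  exact: base_neq.
rewrite -[X in _ --> X]addr0.
have -> : (fun t => expR (- gromov_prod o (u t) (v t))) =
   (fun t => height o / csep o (v t)) +
   (fun t => (csep (u t) (v t) - csep o (u t)) * height o /
      (csep o (u t) * csep o (v t))).
  apply/funext => t; rewrite /= expR_gromov.
  by rewrite -[(_ + _) t]/(_ + _); field; rewrite !gt_eqF ?csep_gt0.
apply: cvgD; first exact: cvg_csep_inv.
have := @cvg_csep_inv o _ _ uw; rewrite (ker_xx H) mulr0 mul0r.
apply: cvg_of_dist => t; rewrite subr0.
have := csep_triangle_add o (u t) (v t); have := csep_triangle_add (v t) o (u t).
rewrite !(csepC (u t) o) (csepC (v t) (u t)).
have := csep_gt0 o (u t); have := csep_gt0 o (v t); have := height_gt0 o.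
move: (csep o (u t)) (csep o (v t)) (csep (u t) (v t)) (height o).
move=> a b c h h0 b0 a0 T1 T2.
have ca : `|c - a| <= b by rewrite ler_norml; apply/andP; split; lra.
rewrite normrM normfV (gtr0_norm (mulr_gt0 a0 b0)) normrM (gtr0_norm h0).
rewrite ler_pdivrMr ?mulr_gt0// (_ : h / a * (a * b) = b * h).
  by rewrite ler_pM2r.
by field; rewrite gt_eqF.
Qed.

(** The Gromov product extends continuously to the boundary.  The filter is
    arbitrary, so that one statement covers both the double limits in the
    definition of convergence at infinity and the simple limits elsewhere. *)
Lemma cvg_gromov o u v z z' : tends F u z -> tends F v z' ->
  expR (- gromov_prod o (u t) (v t)) @[t --> F] --> bdist o z z'.
Proof.
move=> uz vz.
have [zw|zw] := pselect (z = w).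
  by rewrite zw; apply: cvg_gromov_infty => //; rewrite -zw.
have [zw'|zw'] := pselect (z' = w).
  rewrite bdist_sym zw'; under eq_fun do rewrite gromov_sym.
  by apply: cvg_gromov_infty => //; rewrite -zw'.
under eq_fun do rewrite expR_gromov.
apply: cvgM; last first.
  apply: cvgV; first by rewrite gt_eqF// mulr_gt0 ?vis_gt0.
  by apply: cvgM; exact: cvg_csep_base.
apply: cvgMr_tmp.
have : (K (base (u t)) z + height (u t)) + (K (base (v t)) z' + height (v t))
    @[t --> F] --> (0 : R).
  by rewrite -[X in _ --> X]addr0; apply: cvgD; [exact: uz.1|exact: vz.1].
apply: cvg_of_dist => t.
have but := @base_neq _ _ _ _ _ (u t); have bvt := @base_neq _ _ _ _ _ (v t).
have := ker_dist but zw bvt; have := ker_dist bvt zw' zw.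
rewrite /csep (ker_sym H (base (v t)) z) (ker_sym H z' z).
have := height_gt0 (u t); have := height_gt0 (v t).
rewrite !ler_norml => h0 h1 /andP[? ?] /andP[? ?].
by case: (leP (height (u t)) (height (v t))) => ?; apply/andP; split; lra.
Qed.

End filter.
End limits.

(** * The boundary of the cone *)

Section boundary.
Local Open Scope classical_set_scope.
Local Open Scope ring_scope.

Lemma cvgy_expRN (R : realType) (T : Type) (F : set_system T) {FF : Filter F}
  (g : T -> R) : g t @[t --> F] --> +oo <-> expR (- g t) @[t --> F] --> (0 : R).
Proof.
split=> [/cvgryPgt gy|/cvgr0Pnorm_lt g0].
  apply/cvgr0Pnorm_lt => e e0; apply: filterS (gy (- ln e)) => t gt.
  by rewrite gtr0_norm ?expR_gt0// -[ltRHS]lnK ?posrE// ltr_expR ltrNl.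
apply/cvgryPgt => A; apply: filterS (g0 (expR (- A)) (expR_gt0 _)) => t.
by rewrite gtr0_norm ?expR_gt0// ltr_expR ltrN2.
Qed.

(** Completeness of [K] as a metric on [Z] minus [w]. *)
Definition kernel_complete (R : realType) (Z : Type) (K : Z -> Z -> R) (w : Z) :=
  forall u : nat -> Z, (forall n, u n <> w) ->
    (forall e : R, 0 < e -> exists N, forall m n : nat,
      (N <= m)%N -> (N <= n)%N -> K (u m) (u n) < e) ->
    exists2 l, l <> w & K (u n) l @[n --> \oo] --> (0 : R).

Variables (R : realType) (Z : Type) (K : Z -> Z -> R) (w : Z).
Variable H : kernel_at_infty K w.
Implicit Types p q r o : cone H.
Implicit Types u v : nat -> cone H.

Lemma tends_comp (T T' : Type) (F : set_system T) (F' : set_system T')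
  (f : T' -> T) (u : T -> cone H) z :
  f @ F' --> F -> tends F u z -> tends F' (u \o f) z.
Proof.
move=> fF [uz uw]; split=> [/uz|/uw [b ub]]; last exists b.
  exact: (cvg_comp _ _ fF).
exact: (cvg_comp _ _ fF ub).
Qed.

Lemma tends_converges u z : tends \oo u z -> converges_at_infty u.
Proof.
move=> uz; exists (u 0%N).
apply/cvgy_expRN.
rewrite [X in _ --> X](_ : _ = bdist (u 0%N) z z); last first.
  exact/esym/bdist_eq0.
apply: (@cvg_gromov R Z K w H _ _ _ (u 0%N) (u \o fst) (u \o snd)).
  by apply: tends_comp uz; exact: cvg_fst.
by apply: tends_comp uz; exact: cvg_snd.
Qed.

Lemma tends_equiv u v z z' : tends \oo u z -> tends \oo v z' ->
  equiv_at_infty u v <-> z = z'.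
Proof.
move=> uz vz; split=> [[b /cvgy_expRN g0]|zz'].
  apply/(bdist_eq0 b); have g1 := cvg_gromov (FF := eventually_filter) (o := b) uz vz.
  exact: (cvg_unique (@Rhausdorff R) g1 g0).
exists (u 0%N); apply/cvgy_expRN.
have <- : bdist (u 0%N) z z' = 0 by apply/bdist_eq0.
exact: cvg_gromov.
Qed.

(** If [csep b (u n)] is not proper then it has a bounded subsequence, hence it is
    eventually bounded, because the sequence converges at infinity.  The
    convergence then makes [csep (u m) (u n)] small: the base points form a
    Cauchy sequence and the heights tend to 0. *)
Lemma converges_tends u : kernel_complete K w ->
  converges_at_infty u -> exists z, tends \oo u z.
Proof.
move=> Kc [b /cvgy_expRN /cvgr0Pnorm_lt E0].
have h0 := height_gt0 b.
have c0 n := csep_gt0 b (u n).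
have {}E0 e : 0 < e -> exists N, forall m n : nat, (N <= m)%N -> (N <= n)%N ->
    csep (u m) (u n) < e * (csep b (u m) * csep b (u n)) / height b.
  move=> /E0 [[A B] [/= [i _ iA] [j _ jB]] AB].
  exists (maxn i j) => m n; rewrite !geq_max => /andP[im _] /andP[_ jn].
  have /= := AB (m, n) (conj (iA _ im) (jB _ jn)).
  rewrite gtr0_norm ?expR_gt0// expR_gromov.
  by rewrite ltr_pdivrMr ?mulr_gt0// -ltr_pdivlMr.
have [ub|ub] := pselect (csep b (u n) @[n --> \oo] --> +oo).
  by exists w; split=> // _; exists b.
have [B [B0 HB]] : exists B, 0 < B /\ forall N, exists2 n, (N <= n)%N & csep b (u n) <= B.
  apply: contrapT => nB; apply: ub; apply/cvgryPgt => A.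
  apply: contrapT => nA; apply: nB; exists (Num.max A 1).
  split; first by rewrite lt_max ltr01 orbT.
  move=> N; apply: contrapT => nN; apply: nA; exists N => // n /= Nn.
  rewrite ltNge; apply/negP => nAB; apply: nN; exists n => //.
  by rewrite (le_trans nAB)// le_max lexx.
(* For [i] with [csep b (u i) <= B], this choice of the error gives
   [csep (u i) (u n) <= csep b (u n) / 2]; with the triangle inequality,
   [csep b (u n) <= B + csep b (u n) / 2]. *)
have [N0 HN0] : exists N, forall n, (N <= n)%N -> csep b (u n) <= 2 * B.
  have [N HN] := E0 (height b / (2 * B)) (divr_gt0 h0 (mulr_gt0 (ltr0n _ 2) B0)).
  have [i Ni iB] := HB N; exists N => n Nn.
  have := HN i n Ni Nn.
  have := csep_triangle_add (u i) b (u n).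
  rewrite (_ : _ / height b = csep b (u i) / (2 * B) * csep b (u n)); last first.
    by field; rewrite !gt_eqF// mulr_gt0.
  have : csep b (u i) / (2 * B) <= 2^-1.
    by rewrite ler_pdivrMr ?mulr_gt0// mulrA mulVf// mul1r.
  move: (c0 n); move: (csep b (u i) / _) => x; nra.
have cc e : 0 < e -> exists N, forall m n : nat, (N <= m)%N -> (N <= n)%N ->
    csep (u m) (u n) < e.
  move=> e0; have B2 : 0 < 2 * B by rewrite mulr_gt0.
  have [N HN] := E0 (e * height b / (2 * B * (2 * B)))
    (divr_gt0 (mulr_gt0 e0 h0) (mulr_gt0 B2 B2)).
  exists (maxn N N0) => m n; rewrite !geq_max => /andP[Nm N0m] /andP[Nn N0n].
  apply: (lt_le_trans (HN m n Nm Nn)).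
  rewrite [leLHS](_ : _ =
    e * (csep b (u m) * csep b (u n)) / (2 * B * (2 * B))); last first.
    by field; rewrite !gt_eqF.
  rewrite ler_pdivrMr ?mulr_gt0// ler_pM2l//.
  by rewrite ler_pM ?(ltW (c0 _))// HN0.
have [l lw ul] : exists2 l, l <> w & K (base (u n)) l @[n --> \oo] --> (0 : R).
  apply: Kc => [n|e e0]; first exact: base_neq.
  have [N HN] := cc e e0; exists N => m n Nm Nn.
  by apply: le_lt_trans (HN m n Nm Nn); have [] := csep_ge (u m) (u n).
exists l; split=> // _; rewrite -[X in _ --> X]addr0; apply: cvgD => //.
apply/cvgr0Pnorm_lt => e e0; have [N HN] := cc e e0; exists N => // n /= Nn.
rewrite gtr0_norm ?height_gt0//.
by apply: le_lt_trans (HN n n Nn Nn); have [] := csep_ge (u n) (u n).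
Qed.

Lemma tends_exists z : (exists y, y <> w) -> exists u, tends \oo u z.
Proof.
move=> [y yw]; have [zw|zw] := pselect (z = w).
  have Pn (n : nat) : 0 < n.+1%:R :> R by [].
  pose u n : cone H := (exist _ y yw, PosNum (Pn n)).
  exists u; split=> // _; exists (u 0%N); apply/cvgryPge => A.
  have [N _ HN] := nbhs_infty_ger A.
  exists N => // n /= Nn.
  have [_ _] := csep_ge (u 0%N) (u n); apply: le_trans.
  by rewrite (le_trans (HN n Nn))// /height /u/= ler_nat.
have Pn (n : nat) : 0 < (n.+1%:R)^-1 :> R by [].
exists (fun n => (exist _ z zw, PosNum (Pn n)) : cone H); split=> // _.
rewrite /base /height /= (ker_xx H); under eq_fun do rewrite add0r.
exact: cvg_harmonic.
Qed.

Hypothesis Kc : kernel_complete K w.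
Hypothesis Kne : exists y, y <> w.

Lemma boundary_tends z : boundary (cone H) [set v | tends \oo v z].
Proof.
have [u uz] := tends_exists z Kne.
exists u; first exact: tends_converges uz.
apply/seteqP; split=> v /= => [vz|[cv uv]].
  by split; [exact: tends_converges vz|exact/(tends_equiv uz vz)].
have [z' vz'] := converges_tends Kc cv.
by have /(tends_equiv uz vz') -> := uv.
Qed.

Lemma boundary_is_tends (zeta : boundary (cone H)) :
  exists z, val zeta = [set v | tends \oo v z].
Proof.
have [u cu ->] := set_mem (valP zeta).
have [z uz] := converges_tends Kc cu; exists z.
apply/seteqP; split=> v /= => [[cv uv]|vz].
  have [z' vz'] := converges_tends Kc cv.
  by have /(tends_equiv uz vz') -> := uv.
by split; [exact: tends_converges vz|exact/(tends_equiv uz vz)].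
Qed.

(** The lower limits in the definition of the boundary product are limits, and
    they do not depend on the representing sequences; so the infimum is over a
    single value, which is infinite when [z = z']. *)
Lemma boundary_distE o (zeta xi : boundary (cone H)) z z' :
  val zeta = [set v | tends \oo v z] -> val xi = [set v | tends \oo v z'] ->
  boundary_dist o zeta xi = (bdist o z z')%:E.
Proof.
move=> zE xE; rewrite /boundary_dist /boundary_prod zE xE.
have E u v : tends \oo u z -> tends \oo v z' ->
   expeR (- limn_einf (fun i => (gromov_prod o (u i) (v i))%:E)) = (bdist o z z')%:E.
  move=> uz vz; have g := cvg_gromov (FF := eventually_filter) (o := o) uz vz.
  have := bdist_ge0 o z z'; rewrite le_eqVlt => /orP[/eqP d0|d0].
    rewrite -d0 in g *; have gy : (gromov_prod o (u i) (v i))%:E @[i --> \oo] --> +oo%E.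
      by apply/cvgeryP/cvgy_expRN.
    by rewrite (cvg_limn_einf_sup gy).1/=.
  have lg : (gromov_prod o (u i) (v i))%:E @[i --> \oo] --> (- ln (bdist o z z'))%:E.
    apply: cvg_EFin; first exact: nearW.
    have -> : fine \o (fun i => (gromov_prod o (u i) (v i))%:E) =
        - (@ln R \o fun i => expR (- gromov_prod o (u i) (v i))).
      by apply/funext => i; rewrite -[RHS]/(- ln (expR _)) expRK opprK.
    by apply: cvgN; exact: (cvg_comp _ _ g (continuous_ln d0)).
  by rewrite (cvg_limn_einf_sup lg).1 /= opprK lnK.
have [u uz] := tends_exists z Kne; have [v vz] := tends_exists z' Kne.
rewrite -(E u v uz vz); congr (expeR (- _)).
rewrite (_ : [set _ | _] = [set limn_einf (fun i => (gromov_prod o (u i) (v i))%:E)]).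
  by rewrite ereal_inf1.
apply/seteqP; split=> l /= => [[u' [v' [uz' vz' ->]]]|->]; last by exists u, v.
by apply/oppe_inj/expeR_inj; rewrite !E.
Qed.

(** The identification of the boundary with [Z]. *)
Lemma boundary_coordinate : exists f : boundary (cone H) -> Z,
  bijective f /\ forall o zeta xi,
    boundary_dist o zeta xi = (bdist o (f zeta) (f xi))%:E.
Proof.
have /choice[f fE] := boundary_is_tends.
exists f; split; last by move=> o zeta xi; exact: boundary_distE.
have fI : injective f by move=> zeta xi E; apply: val_inj; rewrite !fE E.
pose g z : boundary (cone H) := SigSub (mem_set (boundary_tends z)).
have fg : cancel g f.
  move=> z; have [u uz] := tends_exists z Kne.
  have uf : tends \oo u (f (g z)).
    by have := congr1 (fun A => A u) (fE (g z)); rewrite /= => <-.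
  exact/esym/(tends_equiv uz uf)/(tends_equiv uz uz).
by exists g => // zeta; apply: fI; rewrite fg.
Qed.

Lemma ext_metric_boundary_dist o (f : boundary (cone H) -> Z) : injective f ->
  (forall zeta xi, boundary_dist o zeta xi = (bdist o (f zeta) (f xi))%:E) ->
  ext_metric (boundary_dist o).
Proof.
move=> fI fE; exists set0; split=> [? ? []|].
split=> [zeta xi _ _|zeta xi eta _ _ _|? ? _ []|? []].
- rewrite !fE lee_fin bdist_ge0 bdist_sym; split=> //.
  split=> [[/bdist_eq0/fI]//|->].
  by rewrite (_ : bdist _ _ _ = 0)//; exact/bdist_eq0.
- by rewrite !fE -EFinD lee_fin bdist_triangle.
Qed.

End boundary.

(** * From Moebius structures to kernels *)

Section reduction.
Local Open Scope classical_set_scope.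
Local Open Scope ring_scope.
Variables (R : realType) (Z : Type).
Implicit Types (d : Z -> Z -> \bar R) (Om : set Z).

(** The kernel of an extended metric; the value at the point at infinity itself
    stays 0. *)
Definition finite_part d (x y : Z) : R := cancel_infty (d x y).

Lemma finite_part_fin Om d x y : ext_metric_at Om d -> ~ Om x -> ~ Om y ->
  d x y = (finite_part d x y)%:E.
Proof.
move=> [_ [M _ _ _]] Ox Oy; have [] := M x y Ox Oy.
by rewrite /finite_part; case: (d x y).
Qed.

Lemma finite_part_infty Om d x y : ext_metric_at Om d -> ~ Om x -> Om y ->
  finite_part d x y = 1 /\ finite_part d y x = 1.
Proof.
by move=> [_ [_ _ I _]] Ox Oy; rewrite /finite_part; have [-> ->] := I x y Ox Oy.
Qed.

Lemma finite_part_metric d : ext_metric d ->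
  [/\ forall x y, 0 <= finite_part d x y,
      forall x y, finite_part d x y = 0 <-> x = y &
      forall x y, finite_part d x y = finite_part d y x].
Proof.
move=> [Om dO]; have [U [M _ _ D]] := dO.
have I x y := @finite_part_infty Om d x y dO.
have F x y := @finite_part_fin Om d x y dO.
have W x y : Om x -> Om y -> x = y /\ finite_part d x y = 0.
  by move=> Ox Oy; have xy := U _ _ Ox Oy; rewrite xy /finite_part D.
split=> x y; have [Ox|Ox] := pselect (Om x); have [Oy|Oy] := pselect (Om y).
- by have [_ ->] := W x y Ox Oy.
- by have [_ ->] := I y x Oy Ox.
- by have [-> _] := I x y Ox Oy.
- by have [_ + _ _] := M x y Ox Oy; rewrite (F x y)// lee_fin.
- by have [xy ->] := W x y Ox Oy.
- have [_ ->] := I y x Oy Ox; split=> [/eqP|xy]; first by rewrite oner_eq0.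
  by case: Oy; rewrite -xy.
- have [-> _] := I x y Ox Oy; split=> [/eqP|xy]; first by rewrite oner_eq0.
  by case: Ox; rewrite xy.
- have [_ _ E _] := M x y Ox Oy; rewrite (F x y)// in E.
  by split=> [xy|/E []//]; apply/E; rewrite xy.
- by have [<- _] := W x y Ox Oy.
- by have [-> ->] := I y x Oy Ox.
- by have [-> ->] := I x y Ox Oy.
- by have [_ _ _] := M x y Ox Oy; rewrite (F x y)// (F y x)// => -[].
Qed.

Lemma crt_ge0 d x y z w : ext_metric d ->
  let: (a, b, c) := crt d x y z w in [/\ 0 <= a, 0 <= b & 0 <= c].
Proof. by move=> /finite_part_metric[K0 _ _]; split; apply: mulr_ge0; exact: K0. Qed.

(** For nonnegative representatives the factor of proportionality may be replaced
    by its absolute value. *)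
Lemma proj_eq_triangle (p q : R * R * R) : proj_eq p q \/ proj_eq q p ->
  (let: (a, b, c) := p in [/\ 0 <= a, 0 <= b & 0 <= c]) ->
  (let: (a, b, c) := q in [/\ 0 <= a, 0 <= b & 0 <= c]) ->
  (let: (a, b, c) := p in [/\ a <= b + c, b <= a + c & c <= a + b]) ->
  (let: (a, b, c) := q in [/\ a <= b + c, b <= a + c & c <= a + b]).
Proof.
move: p q => [[a b] c] [[a' b'] c'] E [a0 b0 c0] [a0' b0' c0'] [T1 T2 T3].
have [k [k0 E1 E2 E3]] : exists k, [/\ 0 < k, a' = k * a, b' = k * b & c' = k * c].
  have P (k s t : R) : 0 <= s -> 0 <= t -> s = k * t -> s = `|k| * t.
    by move=> s0 t0 st; rewrite -(ger0_norm s0) st normrM (ger0_norm t0).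
  case: E => -[k k0 [/= E1 E2 E3]].
    exists `|k|^-1; rewrite invr_gt0 normr_gt0.
    have nk : `|k| != 0 by rewrite normr_eq0.
    by split=> //; [rewrite (P k a a')|rewrite (P k b b')|rewrite (P k c c')];
      rewrite ?mulKf.
  by exists `|k|; rewrite normr_gt0; split=> //; exact: P.
by rewrite E1 E2 E3 -!mulrDr !ler_pM2l.
Qed.

Lemma ptolemaic_mobius_class (M : set (Z -> Z -> \bar R)) d :
  mobius_structure M -> ptolemaic_structure M -> M d -> ptolemaic d.
Proof.
move=> [d0 _ ->] [d2 [e0 e2 [_ d02]] P2] [_ e1 [_ d01]] x y z w adm.
have P0 : let: (a, b, c) := crt d0 x y z w in
    [/\ a <= b + c, b <= a + c & c <= a + b].
  apply: (proj_eq_triangle (or_introl (d02 _ _ _ _ adm)) _ _ (P2 _ _ _ _ adm));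
  exact: crt_ge0.
by apply: (proj_eq_triangle (or_intror (d01 _ _ _ _ adm)) _ _ P0); exact: crt_ge0.
Qed.

(** For quadruples that are not admissible, three equal points make the Ptolemy
    inequality trivial. *)
Lemma finite_part_ptolemaic d : ext_metric d -> ptolemaic d ->
  ptolemaic_kernel (finite_part d).
Proof.
move=> ed Pd; have [K0 KE KS] := finite_part_metric ed.
have Kxx x : finite_part d x x = 0 by exact/KE.
split=> // x y z w.
have [adm|] := pselect (admissible x y z w).
  by have [_ + _] := Pd _ _ _ _ adm.
have KK a b c e : 0 <= finite_part d a b * finite_part d c e by exact: mulr_ge0.
move=> nadm; have [[xy yz]|] := pselect (x = y /\ y = z).
  by rewrite xy yz !Kxx !mul0r ?mulr0 ?add0r.
move=> n1; have [[xy yw]|] := pselect (x = y /\ y = w).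
  by rewrite -yw -xy !Kxx !mulr0 ?mul0r ?add0r.
move=> n2; have [[xz zw]|] := pselect (x = z /\ z = w).
  by rewrite -zw -xz !Kxx !mulr0 ?mul0r ?add0r ?addr0.
move=> n3; have [[yz zw]|] := pselect (y = z /\ z = w).
  by rewrite -zw -yz !Kxx !mulr0 ?mul0r ?add0r ?addr0.
by move=> n4; case: nadm.
Qed.

Section kernel_inversion.
Variables (K : Z -> Z -> R) (w : Z).
Hypothesis HK : ptolemaic_kernel K.

(** The scale factor of the inversion at [w]; the value at [w] is a normalisation,
    chosen so that the inverted kernel is 1 between [w] and the other points. *)
Definition inv_weight (x : Z) : R := if pselect (x = w) then 1 else K x w.

Lemma inv_weight_id : inv_weight w = 1.
Proof. by rewrite /inv_weight; case: pselect. Qed.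

Lemma inv_weight_neq x : x <> w -> inv_weight x = K x w.
Proof. by move=> xw; rewrite /inv_weight; case: pselect. Qed.

(** The inversion of [K] at [w]: a kernel with the same cross ratios that has [w]
    as its point at infinity. *)
Definition kernel_inversion (x y : Z) : R := K x y / (inv_weight x * inv_weight y).

Lemma inv_weight_gt0 x : 0 < inv_weight x.
Proof. by rewrite /inv_weight; case: pselect => // xw; exact: ker_gt0. Qed.

Lemma kernel_inversionE x y : K x y = kernel_inversion x y * inv_weight x * inv_weight y.
Proof. by rewrite /kernel_inversion; field; rewrite !gt_eqF ?inv_weight_gt0. Qed.

Lemma kernel_inversion_at_infty : kernel_at_infty kernel_inversion w.
Proof.
have g := inv_weight_gt0.
split; last first.
  move=> x xw; rewrite /kernel_inversion inv_weight_neq// inv_weight_id mulr1 divff//.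
  by rewrite gt_eqF// ker_gt0.
split=> [x y|x y|x y|x y z t].
- by apply: divr_ge0; [exact: (ker_ge0 HK)|rewrite ltW// mulr_gt0].
- rewrite -(ker_eq0 HK) kernel_inversionE; split=> [->|/eqP]; first by rewrite !mul0r.
  by rewrite mulf_eq0 (gt_eqF (g y)) orbF mulf_eq0 (gt_eqF (g x)) orbF => /eqP.
- by rewrite /kernel_inversion (ker_sym HK) mulrC [X in _ / X]mulrC mulrC.
- have := ker_ptolemy HK x y z t; rewrite !kernel_inversionE => P.
  have G : 0 < inv_weight x * inv_weight y * inv_weight z * inv_weight t.
    by rewrite !mulr_gt0.
  by rewrite -(ler_pM2r G); lra.
Qed.

End kernel_inversion.

(** If [d] has a point at infinity, then the inversion at this point changes
    nothing.  Otherwise [d] is bounded, and the inversion at [z0] increases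
    distances up to a constant; so a Cauchy sequence for the inverted kernel
    converges for [d], and its limit is not [z0] because the inverted
    distances to a fixed point stay bounded along the sequence. *)
Lemma kernel_inversion_complete d (z0 : Z) : ext_complete d -> ptolemaic d ->
  exists w, kernel_complete (kernel_inversion (finite_part d) w) w.
Proof.
move=> [Om [dO Cauchy bnd]] Pd.
have ed : ext_metric d by exists Om.
have HK := finite_part_ptolemaic ed Pd.
have [K0 KE KS] := finite_part_metric ed.
have Fin x y : ~ Om x -> ~ Om y -> d x y = (finite_part d x y)%:E.
  exact: finite_part_fin.
have {}Cauchy (u : nat -> Z) : (forall n, ~ Om (u n)) ->
  (forall e : R, 0 < e -> exists N, forall m n : nat,
      (N <= m)%N -> (N <= n)%N -> finite_part d (u m) (u n) < e) ->
    exists2 l, ~ Om l & finite_part d (u n) l @[n --> \oo] --> (0 : R).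
  move=> uO uC; have [|l lO ul] := Cauchy u uO.
    move=> e /uC [N HN]; exists ([set n | (N <= n)%N], [set n | (N <= n)%N]) => /=.
      by split; exists N.
    by move=> [m n] /= [Nm Nn]; rewrite Fin// lte_fin HN.
  exists l => //.
  have -> : (fun n => finite_part d (u n) l) = fine \o (fun n => d (u n) l).
    by apply/funext => n; rewrite /= Fin.
  exact: fine_cvg.
have [[w Ow]|nO] := pselect (Om !=set0).
  exists w.
  have OE x : x <> w -> ~ Om x by move=> xw Ox; apply: xw; exact: (dO.1 _ _ Ox Ow).
  have w1 x : inv_weight (finite_part d) w x = 1.
    have [->|xw] := pselect (x = w); first exact: inv_weight_id.
    rewrite inv_weight_neq//.
    by have [] := finite_part_infty dO (OE _ xw) Ow.
  have -> : kernel_inversion (finite_part d) w = finite_part d.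
    by apply/funext => x; apply/funext => y; rewrite /kernel_inversion !w1 mulr1 divr1.
  move=> u uw uC; have [l lO ul] := Cauchy u (fun n => OE _ (uw n)) uC.
  by exists l => // lw; apply: lO; rewrite lw.
have O x : ~ Om x by move=> Ox; apply: nO; exists x.
have tri x y z : finite_part d x z <= finite_part d x y + finite_part d y z.
  by have [_ [_ T _ _]] := dO; have := T x y z (O _) (O _) (O _); rewrite !Fin// lee_fin.
have [r [r0 Kr]] : exists r, 0 < r /\ forall x y, finite_part d x y <= r.
  have /contrapT[r dr] := contra_not bnd nO.
  exists (Num.max r 1); split=> [|x y]; first by rewrite lt_max ltr01 orbT.
  by have := dr x y (O _) (O _); rewrite Fin// lee_fin le_max => ->.
have dist x y z : `|finite_part d x z - finite_part d y z| <= finite_part d x y.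
  have := tri x y z; have := tri y x z; rewrite (KS y x) ler_norml => T1 T2.
  by apply/andP; split; lra.
exists z0 => u uw uC.
pose K := finite_part d; rewrite -/K in K0 KE KS tri Kr dist Cauchy HK uC *.
have wE := @inv_weight_neq K z0.
have m0 n : 0 < K (u n) z0 by exact: ker_gt0.
have [l _ ul] : exists2 l, ~ Om l & K (u n) l @[n --> \oo] --> (0 : R).
  apply: Cauchy => // e e0.
  have [N HN] := uC (e / (r * r)) (divr_gt0 e0 (mulr_gt0 r0 r0)).
  exists N => m n Nm Nn; have := HN m n Nm Nn.
  rewrite /kernel_inversion !wE// ltr_pdivrMr ?mulr_gt0// => /lt_le_trans; apply.
  rewrite mulrAC ler_pdivrMr ?mulr_gt0// ler_pM2l//.
  by apply: ler_pM => //; exact: ltW.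
have lz : l <> z0.
  (* If [l = z0], then [K (u N) z0 <= K (u N) (u n) + K (u n) z0], where both terms
     on the right tend to 0 with [n]. *)
  move=> lz; rewrite lz in ul; have [N HN] := uC 1 ltr01.
  have /cvgr0Pnorm_lt /(_ (K (u N) z0 / (K (u N) z0 + 1))) := ul.
  rewrite divr_gt0 ?addr_gt0// => /(_ isT) [N' _ /(_ (maxn N N') (leq_maxr _ _))] /=.
  rewrite gtr0_norm// ltr_pdivlMr ?addr_gt0//.
  have := HN N (maxn N N') (leqnn _) (leq_maxl _ _).
  rewrite /kernel_inversion !wE// ltr_pdivrMr ?mulr_gt0// mul1r.
  have := tri (u N) (u (maxn N N')) z0; rewrite -/K; lra.
exists l => //.
have -> : (fun n => kernel_inversion K z0 (u n) l) =
    (fun n => K (u n) l * (K (u n) z0 * K l z0)^-1).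
  by apply/funext => n; rewrite /kernel_inversion !wE.
rewrite -[X in _ --> X](mul0r (K l z0 * K l z0)^-1); apply: cvgM => //.
apply: cvgV; first by rewrite mulf_eq0 gt_eqF ?ker_gt0.
by apply: cvgMr_tmp; apply: cvg_of_dist ul => n; exact: dist.
Qed.

End reduction.

Theorem theorem1p3 (R : realType) (Z : Type)
    (hZ : exists x y : Z, x <> y)
    (M : set (Z -> Z -> \bar R))
    (hM : mobius_structure M)
    (hcomplete : complete_structure M)
    (hptolemaic : ptolemaic_structure M) :
  exists X : metricType R,
    asymptotically_PT X /\
    exists f : boundary X -> Z,
      bijective f /\
      forall o : X, mobius_space_map (canonical_structure o) M f.
Proof.
have [x0 [y0 xy0]] := hZ.
have [d Md dc] := hcomplete.
have Pd := ptolemaic_mobius_class hM hptolemaic Md.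
have ed : ext_metric d by case: dc => Om [? _ _]; exists Om.
have HK := finite_part_ptolemaic ed Pd.
have [w wc] := kernel_inversion_complete x0 dc Pd.
have H := kernel_inversion_at_infty w HK.
have Kne : exists y, y <> w.
  have [x0w|x0w] := pselect (x0 = w); last by exists x0.
  by exists y0 => y0w; apply: xy0; rewrite x0w.
exists (cone H : metricType R); split; first exact: cone_PT.
have [f [fB fE]] := boundary_coordinate H wc Kne.
exists f; split=> // o; exists (boundary_dist o), d; split=> //.
  have eb := ext_metric_boundary_dist (bij_inj fB) (fE o).
  by split=> //; split=> // x y z t _; exists 1%R; rewrite ?oner_neq0// !mul1r.
have fI := bij_inj fB; split=> // x y z t _.
(* Up to the constant [height o], [d] is the boundary metric rescaled by [g]. *)
pose g xi := (inv_weight (finite_part d) w (f xi) * vis o (f xi))%R.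
have ho := height_gt0 o.
have g0 xi : (0 < g xi)%R by rewrite mulr_gt0 ?inv_weight_gt0 ?vis_gt0.
have KE xi eta : cancel_infty (d (f xi) (f eta)) =
    (cancel_infty (boundary_dist o xi eta) * g xi * g eta / height o)%R.
  rewrite fE -[LHS]/(finite_part d _ _) (kernel_inversionE w HK) /= /bdist /g.
  by field; rewrite ?gt_eqF ?vis_gt0.
move: g g0 KE => g g0 KE.
exists (g x * g y * g z * g t / (height o * height o))%R.
  by rewrite gt_eqF// divr_gt0 ?mulr_gt0.
by rewrite /crt /= !KE; split; field; rewrite gt_eqF.
Qed.
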